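(* Assume that there exist two constants $V_1\ge0$ and $V_2\ge0$ such that $$\mathbb E\big[(G_{X_1}(X_1))^2\big]\le V_1\quad\text{and}\quad\mathbb E\big[(G_\varepsilon(\varepsilon))^2\big]\le V_2.$$ Let $V=V_1(K_{n-1}(\rho))^2+V_2\sum_{k=2}^n(K_{n-k}(\rho))^2$. Then, for any $p\ge2$, there exist two positive constants $C_1(p)$ and $C_2(p)$ (depending only on $p$) such that, for any $t>0$, $$\mathbb P(|S_n|>t)\le\frac1{t^p}\left\{C_1(p)V^{p/2}+C_2(p)\,\Big\|\max\Big\{K_{n-1}(\rho)G_{X_1}(X_1),\max_{2\le i\le n}K_{n-i}(\rho)G_\varepsilon(\varepsilon_i)\Big\}\Big\|_{w,p}^p\right\}.$$
   Context: $(\mathcal X,d)$ and $(\mathcal Y,\delta)$ are complete separable metric spaces; $(\varepsilon_i)_{i\ge1}$ is a sequence of iid $\mathcal Y$-valued random variables; $X_1$ is an $\mathcal X$-valued random variable independent of $(\varepsilon_i)_{i\ge2}$. The Markov chain is $X_n=F(X_{n-1},\varepsilon_n)$ for $n\ge2$, where $F:\mathcal X\times\mathcal Y\to\mathcal X$ is measurable and satisfies, for some $\rho\in[0,1)$ and $C>0$, $\mathbb E[d(F(x,\varepsilon_1),F(x',\varepsilon_1))]\le\rho\,d(x,x')$ for all $x,x'\in\mathcal X$, and $d(F(x,y),F(x,y'))\le C\,\delta(y,y')$ for all $x\in\mathcal X$, $y,y'\in\mathcal Y$. $n\ge1$ and $f:\mathcal X^n\to\mathbb R$ are arbitrary with $|f(x_1,\ldots,x_n)-f(x_1',\ldots,x_n')|\le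 d(x_1,x_1')+\cdots+d(x_n,x_n')$, and $S_n=f(X_1,\ldots,X_n)-\mathbb E[f(X_1,\ldots,X_n)]$. Let $P_{X_1}$ be the law of $X_1$, $P_\varepsilon$ the common law of the $\varepsilon_k$'s, $G_{X_1}(x)=\int d(x,x')P_{X_1}(dx')$, $G_\varepsilon(y)=\int C\,\delta(y,y')P_\varepsilon(dy')$; $G_\varepsilon(\varepsilon)$ denotes a random variable distributed as $G_\varepsilon(\varepsilon_k)$. For $k\in\mathbb N$, $K_k(\rho)=1+\rho+\cdots+\rho^k$. For a real random variable $Z$ and $p\ge1$, the weak moment is $\|Z\|_{w,p}^p=\sup_{x>0}x^p\,\mathbb P(|Z|>x)\in[0,+\infty]$. *)

(* Defs.v *)
From HB Require Import structures.
From mathcomp Require Import all_boot all_order all_algebra finmap.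
From mathcomp Require Import all_classical all_reals all_analysis.

Set Implicit Arguments.
Unset Strict Implicit.
Unset Printing Implicit Defensive.

Import Order.TTheory GRing.Theory Num.Theory.
Import numFieldNormedType.Exports.

Local Open Scope classical_set_scope.
Local Open Scope ring_scope.

(* The base point demanded by [Complete] is harmless: the spaces below carry
   random variables, hence are nonempty. *)
#[short(type="completeMetricType")]
HB.structure Definition CompleteMetric (R : numDomainType) :=
  { T of Complete T & Metric R T }.

Definition separable (T : topologicalType) : Prop :=
  exists2 D : set T, countable D & dense D.

Notation borel T := (g_sigma_algebraType (@open T)).

Section independence.
Context {d} {Omega : measurableType d} {R : realType} (P : probability Omega R).
Context {d'} {T : measurableType d'}.
Local Open Scope ereal_scope.

Definition sigma_rv (X : {RV P >-> T}) : set_system Omega :=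
  preimage_set_system setT X measurable.

Definition sigma_family (I : set nat) (X : nat -> {RV P >-> T}) :
    set_system Omega :=
  <<s \bigcup_(i in I) sigma_rv (X i) >>.

Definition independent_systems (F G : set_system Omega) : Prop :=
  forall A B, F A -> G B -> P (A `&` B) = P A * P B.

Definition mutually_independent (I : set nat) (X : nat -> {RV P >-> T}) : Prop :=
  forall (J : {fset nat}) (A : nat -> set T),
    [set` J] `<=` I -> (forall i, i \in J -> measurable (A i)) ->
    P (\bigcap_(i in [set` J]) (X i @^-1` A i)) =
    \prod_(i <- J) P (X i @^-1` A i).

Definition identically_distributed (I : set nat) (X : nat -> {RV P >-> T}) :
    Prop :=
  forall i j, I i -> I j -> forall A, measurable A ->
    distribution P (X i) A = distribution P (X j) A.

Definition iid (I : set nat) (X : nat -> {RV P >-> T}) : Prop :=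
  mutually_independent I X /\ identically_distributed I X.

End independence.

Definition lipschitz1 (R : realType) (S : completeMetricType R) (n : nat)
    (f : ('I_n -> S) -> R) : Prop :=
  forall x x' : 'I_n -> S, `|f x - f x'| <= \sum_(i < n) mdist (x i) (x' i).

Definition geomsum (R : realType) (rho : R) (k : nat) : R :=
  \sum_(0 <= i < k.+1) rho ^+ i.

(* [\int c * mdist x x' mu(dx')], kept in [\bar R] because it may a priori be
   infinite; c = 1 gives G_{X_1} and c = C gives G_eps. *)
Definition mean_dist (R : realType) (S : completeMetricType R)
    (mu : probability (borel S) R) (c : R) (x : S) : \bar R :=
  (\int[mu]_x' (c * mdist x x')%:E)%E.

(* The p-th power [||Z||_{w,p}^p] of the weak moment. *)
Definition weak_moment {d} {Omega : measurableType d} {R : realType}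
    (P : probability Omega R) (p : R) (Z : Omega -> \bar R) : \bar R :=
  ereal_sup [set ((x `^ p)%:E * P [set w | x%:E < `|Z w|])%E
            | x in [set x : R | 0 < x]].

(* Main.v *)
Require Import Defs.
From HB Require Import structures.
From mathcomp Require Import all_boot all_order all_algebra finmap.
From mathcomp Require Import all_classical all_reals all_analysis.
From mathcomp Require Import measurable_realfun ring lra.

Set Implicit Arguments.
Unset Strict Implicit.
Unset Printing Implicit Defensive.

Import Order.TTheory GRing.Theory Num.Theory.
Import numFieldNormedType.Exports.

Local Open Scope classical_set_scope.
Local Open Scope ring_scope.

(** The deviation [S_n] is the sum of [n] martingale differences, obtained by
    conditioning on [X 1], then on [eps 2], and so on up to [eps n]. Conditional
    expectations are written out as integrals over the innovations that have not
    yet been revealed ([value]). Because [F] contracts in mean and [f] is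
    Lipschitz, the conditional expectation at time [k] is Lipschitz in its last
    coordinate with constant [1 + rho + ... + rho ^ (n - k)]
    ([value_lipschitz]). The [k]-th difference is a centred Lipschitz function of
    the [k]-th source of randomness, so it is dominated by
    [K (n - k) * Geps (eps k)], or by [K n.-1 * GX (X 1)] when [k = 1]
    ([incr_le]). The dominating variable is independent of the past: the
    conditional variances have deterministic bounds, whose sum is [V].

    The rest is an argument of Fuk and Nagaev. Outside the event [M > y] all
    differences are at most [y], and [S_n] is the sum of the differences truncated
    from above at [y]. Since [expR s <= 1 + s + s ^ 2 * expR u] for [s <= u] and
    [0 <= u], the exponential moment of order [l] of the truncated sum is at most
    [expR (l ^ 2 * expR (l * y) * V)] ([mgf_truncated], [expR_psum_le]), so that
    [P (S_n > t) <= P (M > y) + expR (l ^ 2 * expR (l * y) * V - l * t)]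
    ([upper_tail]). Taking [y] to be a multiple of [t] and optimizing [l] turns the
    exponential into a multiple of [V ^ (p / 2) / t ^ p] ([optimize_exponent]),
    while [P (M > y)] is at most [y ^ (- p)] times the weak moment. The lower tail
    is the upper tail of [- f].

    The past up to time [k] is [Omega] equipped with the sigma-algebra generated by
    [X 1], [eps 2], ..., [eps k]. It is independent of [eps k.+1]
    ([independent_past]), so conditioning on it amounts to Tonelli's theorem on a
    product space ([mgf_independent_step]). *)

(** * Truncated exponential moments *)

(** A one-sided Taylor bound: the remainder only has to be paid at the upper
    bound [u] of [s], which is what makes truncation from above sufficient. For
    [s >= 0] it follows from applying [1 - s <= expR (- s)] twice, and for
    [s <= 0] from [expR s <= 1 / (1 - s) <= 1 + s + s ^+ 2]. *)
Lemma expR_le_quadratic (R : realType) (s u : R) : 0 <= u -> s <= u ->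
  expR s <= 1 + s + s ^+ 2 * expR u.
Proof.
move=> u0 su.
have esN : expR s * (1 - s) <= 1.
  apply: (@le_trans _ _ (expR s * expR (- s))).
    by rewrite ler_wpM2l ?expR_ge0//; exact: expR_ge1Dx.
  by rewrite -expRD subrr expR0.
have es0 := expR_gt0 s.
have eu : 1 <= expR u by rewrite -expR0 ler_expR.
have esu : expR s <= expR u by rewrite ler_expR.
have [s0|s0] := lerP 0 s.
  have : 0 <= s ^+ 2 * (expR u - expR s) by rewrite mulr_ge0 ?sqr_ge0 ?subr_ge0.
  nra.
have : 0 <= s ^+ 2 * (expR u - 1) by rewrite mulr_ge0 ?sqr_ge0 ?subr_ge0.
have s1 : 0 < 1 - s by lra.
suff : expR s <= 1 + s + s ^+ 2 by lra.
rewrite -(ler_pM2r s1); apply: (le_trans esN).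
have : 0 <= s ^+ 2 * - s by rewrite mulr_ge0 ?sqr_ge0; lra.
nra.
Qed.

(** Truncating a centred variable from above does not require recentring it:
    [min (h, y) <= h] and [min (h, y) ^ 2 <= h ^ 2], so the linear
    term is bounded by one that integrates to zero, and the quadratic one by one
    that integrates to at most [v]. *)
Lemma mgf_truncated d (T : measurableType d) (R : realType)
    (mu : probability T R) (h : T -> R) (l y v : R) :
  0 <= l -> 0 <= y -> mu.-integrable setT (EFin \o h) ->
  (\int[mu]_x (h x)%:E = 0)%E -> (\int[mu]_x (h x ^+ 2)%:E <= v%:E)%E ->
  (\int[mu]_x (expR (l * Num.min (h x) y))%:E
     <= (expR (l ^+ 2 * expR (l * y) * v))%:E)%E.
Proof.
move=> l0 y0 ih h0 h2.
have mh : measurable_fun setT h by apply/measurable_EFinP; exact: measurable_int ih.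
have mh2 : measurable_fun setT (fun x => (h x ^+ 2)%:E).
  by apply/measurable_EFinP; exact: measurable_funX.
have ih2 : mu.-integrable setT (fun x => (h x ^+ 2)%:E).
  apply/integrableP; split => //.
  under eq_integral do rewrite gee0_abs ?lee_fin ?sqr_ge0//.
  by rewrite (le_lt_trans h2)// ltry.
pose c := l ^+ 2 * expR (l * y).
have c0 : 0 <= c by rewrite mulr_ge0 ?sqr_ge0 ?expR_ge0.
have key x : expR (l * Num.min (h x) y) <= 1 + l * h x + c * h x ^+ 2.
  have ly : l * Num.min (h x) y <= l * y by rewrite ler_wpM2l// ge_min lexx orbT.
  apply: (le_trans (expR_le_quadratic (mulr_ge0 l0 y0) ly)).
  rewrite lerD ?lerD2l ?ler_wpM2l ?ge_min ?lexx//.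
  rewrite exprMn /c mulrAC ler_wpM2l ?c0//.
  case: (lerP (h x) y) => // hy.
  by rewrite ler_pXn2r ?nnegrE ?(le_trans y0 (ltW hy))// ltW.
have i1 : mu.-integrable setT (cst (1%:E : \bar R)) by exact: finite_measure_integrable_cst.
have i2 : mu.-integrable setT (fun x => (l%:E * (h x)%:E)%E) by exact: integrableZl.
have i3 : mu.-integrable setT (fun x => (c%:E * (h x ^+ 2)%:E)%E) by exact: integrableZl.
apply: (@le_trans _ _ (\int[mu]_x (1%:E + l%:E * (h x)%:E + c%:E * (h x ^+ 2)%:E)))%E.
  apply: ge0_le_integral => //.
  - apply/measurable_EFinP; apply: measurableT_comp => //.
    by apply: measurable_funM => //; exact: measurable_minr.
  - by apply: emeasurable_funD;
      [apply: emeasurable_funD|]; apply: measurable_int; [exact: i1|exact: i2|exact: i3].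
  - by move=> x _; rewrite -!EFinM -!EFinD lee_fin; exact: key.
rewrite integralD//; last exact: integrableD.
rewrite integralD// !integralZl// h0 mule0 adde0 integral_cst//.
rewrite /= probability_setT mule1.
apply: (@le_trans _ _ (1%:E + c%:E * v%:E)%E).
  by rewrite leeD2l// lee_wpmul2l// lee_fin.
by rewrite -EFinM -EFinD lee_fin expR_ge1Dx.
Qed.

(** * Integrating out an independent variable *)

Section independent_pair.
Context d d1 d2 (Omega : measurableType d) (T1 : measurableType d1)
  (T2 : measurableType d2) (R : realType) (P : probability Omega R).
Context (Z : {RV P >-> T1}) (xi : {RV P >-> T2}) (nu : probability T2 R).
Local Open Scope ereal_scope.

(** Independence of [Z] and [xi] and the fact that [xi] has law [nu], in one
    statement: this is the form in which the innovations of the chain occur,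
    since they share the law of the first of them. *)
Definition independent_with_law := forall A B, measurable A -> measurable B ->
  P (Z @^-1` A `&` xi @^-1` B) = P (Z @^-1` A) * nu B.

Context (ZxiP : independent_with_law).

Let pairZxi w := (Z w, xi w).

Let mpairZxi : measurable_fun setT pairZxi.
Proof. exact: measurable_fun_pair. Qed.

HB.instance Definition _ := isMeasurableFun.Build _ _ _ _ pairZxi mpairZxi.

Let joint_law A : measurable A ->
  (distribution P Z \x nu) A = distribution P pairZxi A.
Proof.
apply: product_measure_unique => B C mB mC.
by rewrite /= -ZxiP.
Qed.

Lemma ge0_integral_independent (f : T1 * T2 -> \bar R) :
  measurable_fun setT f -> (forall z, 0 <= f z) ->
  \int[P]_w f (Z w, xi w) = \int[P]_w \int[nu]_y f (Z w, y).
Proof.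
move=> mf f0.
rewrite -(@ge0_integral_distribution _ _ _ _ _ P pairZxi f)//.
transitivity (\int[distribution P Z \x nu]_z f z).
  by apply: eq_measure_integral => A mA _; exact/esym/joint_law.
rewrite fubini_tonelli1// ge0_integral_distribution//.
- exact: measurable_fun_fubini_tonelli_F.
- by move=> z; exact: integral_ge0.
Qed.

Lemma integral_independent (f : T1 * T2 -> \bar R) :
  measurable_fun setT f -> P.-integrable setT (fun w => f (Z w, xi w)) ->
  \int[P]_w f (Z w, xi w) =
  \int[distribution P Z]_z \int[nu]_y f (z, y).
Proof.
move=> mf intf.
rewrite -(@integral_distribution _ _ _ _ _ P pairZxi f)//.
rewrite integral12_prod_meas1.
  by apply: eq_measure_integral => A mA _; exact/esym/joint_law.
apply/integrableP; split => //.
rewrite (@eq_measure_integral _ _ _ _ (distribution P pairZxi)); last first.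
  by move=> A mA _; exact: joint_law.
rewrite ge0_integral_distribution//; last exact: measurableT_comp.
by have /integrableP[] := intf.
Qed.

(** The substitute for conditioning on the past [Z]: since [xi] is integrated
    out first, [z] is frozen in [D (z, xi)], and [mgf_truncated] applies with a
    bound that does not depend on [z]. The factor [Y] carries the product of the
    exponentials of the earlier increments. *)
Lemma mgf_independent_step (Y : T1 -> R) (D : T1 * T2 -> R) (l y v : R) :
  (0 <= l)%R -> (0 <= y)%R -> measurable_fun setT Y -> (forall z, 0 <= Y z)%R ->
  measurable_fun setT D ->
  (forall z, nu.-integrable setT (fun x => (D (z, x))%:E)) ->
  (forall z, \int[nu]_x (D (z, x))%:E = 0) ->
  (forall z, \int[nu]_x (D (z, x) ^+ 2)%:E <= v%:E) ->
  \int[P]_w (Y (Z w) * expR (l * Num.min (D (Z w, xi w)) y))%:E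
    <= (expR (l ^+ 2 * expR (l * y) * v))%:E * \int[P]_w (Y (Z w))%:E.
Proof.
move=> l0 y0 mY Y0 mD iD D0 D2.
have mE : measurable_fun setT (fun z => expR (l * Num.min (D z) y)).
  apply: measurableT_comp => //.
  by apply: measurable_funM => //; exact: measurable_minr.
pose f z := (Y z.1 * expR (l * Num.min (D z) y))%:E.
have mf : measurable_fun setT f.
  apply/measurable_EFinP/measurable_funM => //.
  by apply: (measurableT_comp mY); exact: measurable_fst.
rewrite (@ge0_integral_independent f)//; last first.
  by move=> z; rewrite lee_fin mulr_ge0// expR_ge0.
have mYZ : measurable_fun setT (Y \o Z) by exact: measurableT_comp.
rewrite -ge0_integralZl//; last 2 first.
- exact/measurable_EFinP.
- by move=> w _; rewrite lee_fin.
apply: ge0_le_integral => //.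
- move=> w _; apply: integral_ge0 => x _.
  by rewrite lee_fin mulr_ge0// expR_ge0.
- apply: (measurableT_comp (f := fun z => \int[nu]_x f (z, x))) => //.
  apply: measurable_fun_fubini_tonelli_F => //.
  by move=> z; rewrite lee_fin mulr_ge0// expR_ge0.
- by apply/measurable_EFinP; exact: measurable_funM.
move=> w _.
under eq_integral do rewrite /f EFinM/=.
rewrite ge0_integralZl//; last 2 first.
- by apply/measurable_EFinP; exact: measurable_fun_pair2 mE.
- by rewrite lee_fin.
rewrite muleC lee_wpmul2r ?lee_fin//.
by apply: mgf_truncated => //; exact: iD.
Qed.

End independent_pair.

(** * Lipschitz functions on separable metric spaces are measurable *)

Section separable_metric.
Context {R : realType} (S : completeMetricType R).

Lemma open_mdist_lt (x : S) (e : R) : open [set y : S | mdist x y < e].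
Proof.
rewrite openE => y /= xye; apply/metricType_numDomainType.nbhs_mdistP.
exists (e - mdist x y) => /=; first by rewrite subr_gt0.
move=> z /= yz; apply: (le_lt_trans (metric_triangle x y z)).
by rewrite addrC -ltrBrDr.
Qed.

Lemma dense_sequence : separable S ->
  exists D : nat -> S, forall x e, 0 < e -> exists k, mdist x (D k) < e.
Proof.
case=> A cA dA.
have ne x e : 0 < e -> [set y : S | mdist x y < e] `&` A !=set0.
  by move=> e0; apply: dA; [exists x|exact: open_mdist_lt]; rewrite /= mdistxx.
move/pfcard_geP : cA => [A0|[D]].
  by have [y [_]] := ne point 1 ltr01; rewrite A0.
exists D => x e e0; have [y [xy Ay]] := ne x e e0.
by have [k _ Dk] := 'surj_D Ay; exists k; rewrite Dk.
Qed.

Lemma measurable_fun_sublevel d (T : measurableType d) (h : T -> R) :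
  (forall a, measurable [set w | h w < a]) -> measurable_fun setT h.
Proof.
move=> mh; apply: (measurability _ (RGenInftyO.measurableE R)) => //= _ [_ [a ->] <-].
by rewrite setTI [X in measurable X](_ : _ = [set w | h w < a]).
Qed.

Lemma measurable_mdist (q : S) : measurable_fun setT (mdist q : borel S -> R).
Proof.
apply: measurable_fun_sublevel => a; apply: sub_sigma_algebra.
exact: open_mdist_lt.
Qed.

(** Borel measurability of a Lipschitz function of finitely many coordinates,
    with no reference to the product topology: by the McShane formula,
    [phi (Z w)] is the infimum of [phi x + L * \sum_(i <- s) d (x i, Z i w)]
    over the countably many [x] with coordinates in a dense sequence, so its
    sublevel sets are countable unions of sublevel sets of measurable
    functions. *)
Lemma measurable_lipschitz_seq d (T : measurableType d) (phi : (nat -> S) -> R)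
    (L : R) (s : seq nat) (Z : nat -> T -> borel S) :
  separable S -> 0 <= L ->
  (forall x x', `|phi x - phi x'| <= L * \sum_(i <- s) mdist (x i) (x' i)) ->
  (forall i, i \in s -> measurable_fun setT (Z i)) ->
  measurable_fun setT (fun w => phi (Z^~ w)).
Proof.
move=> sepS L0 lip mZ; have [D DP] := dense_sequence sepS.
(* Points with coordinates in the dense sequence are coded by [seq nat], which is
   countable; the default value of [nth] does no harm, since [phi] only sees
   the coordinates in [s]. *)
pose x (t : seq nat) i := D (nth 0%N t i).
pose u t w := phi (x t) + L * \sum_(i <- s) mdist (x t i) (Z i w).
have mu_ t : measurable_fun setT (u t).
  apply: measurable_funD => //; apply: measurable_funM => //.
  rewrite [X in measurable_fun _ X](_ : _ =
    fun w => \sum_(i <- s) if i \in s then mdist (x t i) (Z i w) else 0).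
    2: by apply/funext => w; rewrite [LHS]big_seq [LHS]big_mkcond.
  apply: measurable_sum => i; case: (boolP (i \in s)) => // si.
  exact: measurableT_comp (measurable_mdist _) (mZ i si).
apply: measurable_fun_sublevel => a.
rewrite [X in measurable X](_ : _ = \bigcup_t [set w | u t w < a]); last first.
  apply/seteqP; split => w /=; last first.
    move=> [t _ /=]; apply: le_lt_trans; rewrite /u.
    have := lip (Z^~ w) (x t); rewrite ler_distl => /andP[_].
    by under [X in _ <= _ + L * X -> _]eq_bigr do rewrite metric_sym.
  (* A code [t] for a point so close to [Z w] that [2 * L] times the distance is
     less than the gap [a - phi (Z w)]. *)
  move=> phia; pose e := (a - phi (Z^~ w)) / (2 * L + 1) / (size s).+1%:R.
  have L1 : 0 < 2 * L + 1 by rewrite ltr_wpDl// mulr_ge0.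
  have e0 : 0 < e by rewrite !divr_gt0// subr_gt0.
  pose k i := projT1 (cid (DP (Z i w) e e0)).
  have kP i : mdist (Z i w) (D (k i)) < e by exact: (projT2 (cid (DP _ _ _))).
  pose t := mkseq k (foldr maxn 0%N s).+1.
  have tE i : i \in s -> nth 0%N t i = k i.
    move=> si; rewrite nth_mkseq// ltnS.
    elim: (s) si => //= j r IHr; rewrite inE => /orP[/eqP ->|/IHr ir].
      exact: leq_maxl.
    by rewrite (leq_trans ir)// leq_maxr.
  have se : \sum_(i <- s) mdist (Z i w) (x t i) <= e * (size s)%:R.
    have <- : \sum_(i <- s) e = e * (size s)%:R.
      by rewrite big_const_seq count_predT iter_addr_0 mulr_natr.
    rewrite big_seq [leRHS]big_seq; apply: ler_sum => i si.
    by rewrite /x tE// ltW.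
  exists t => //=; rewrite /u.
  have := lip (Z^~ w) (x t); rewrite ler_distl => /andP[h _].
  have -> : \sum_(i <- s) mdist (x t i) (Z i w) = \sum_(i <- s) mdist (Z i w) (x t i).
    by apply: eq_bigr => i _; rewrite metric_sym.
  set q := \sum_(i <- s) _ in se h *.
  have q1 : (2 * L + 1) * q < a - phi (Z^~ w).
    rewrite mulrC -ltr_pdivlMr//; apply: (le_lt_trans se).
    rewrite /e mulrAC -mulrA gtr_pMr ?divr_gt0 ?subr_gt0//.
    by rewrite ltr_pdivrMr// mul1r ltr_nat.
  have q0 : 0 <= q by apply: sumr_ge0 => i _; exact: mdist_ge0.
  by nra.
apply: countable_bigcupT_measurable => [|t]; first exact: countableP.
have := mu_ t; move/(_ measurableT `]-oo, a[%classic (measurable_itv _)).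
by rewrite setTI [X in measurable X -> _](_ : _ = [set w | u t w < a]).
Qed.

Lemma measurable_lipschitz (h : S -> R) (L : R) : separable S -> 0 <= L ->
  (forall x x', `|h x - h x'| <= L * mdist x x') ->
  measurable_fun setT (h : borel S -> R).
Proof.
move=> sepS L0 lip.
apply: (@measurable_lipschitz_seq _ (borel S) (fun x => h (x 0%N)) L [:: 0%N]
  (fun _ x => x)) => //.
by move=> x x'; rewrite big_seq1.
Qed.

End separable_metric.

(** * The past of the chain *)

Section past.
Context d d1 d2 (Omega : measurableType d) (T1 : measurableType d1)
  (T2 : measurableType d2) (R : realType) (P : probability Omega R).
Context (X1 : {RV P >-> T1}) (eps : nat -> {RV P >-> T2}).
Context (iid_eps : iid [set i | (1 <= i)%N] eps)
  (X1_eps : independent_systems P (sigma_rv X1)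
              (sigma_family [set i | (2 <= i)%N] eps)).
Local Open Scope ereal_scope.

Definition past_index k : {fset nat} := [fset i in index_iota 2 k.+1]%fset.

Lemma in_past_index k i : (i \in past_index k) = (2 <= i <= k)%N.
Proof. by rewrite !inE mem_index_iota ltnS. Qed.

(** A pi-system generating the sigma-algebra of [X1, eps 2, ..., eps k]: on its
    members probabilities factorize explicitly, and two finite measures that
    agree on them agree on the sigma-algebra. *)
Definition past_rect k : set_system Omega :=
  [set E | exists A B, [/\ measurable A, forall i, measurable (B i) &
    E = X1 @^-1` A `&` \bigcap_(i in [set` past_index k]) eps i @^-1` B i]].

(** The space [Omega] itself equipped with the smaller sigma-algebra, so that the
    past is a random variable (the identity map) with values in it and every
    function of the past is a function on [Omega]. *)
Definition past k := g_sigma_algebraType (past_rect k).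

Lemma past_rect_measurable k : past_rect k `<=` measurable.
Proof.
move=> _ [A [B [mA mB ->]]]; apply: measurableI; first exact: measurable_funPTI.
by apply: fin_bigcap_measurable => // i _; exact: measurable_funPTI.
Qed.

Lemma past_rectI k : setI_closed (past_rect k).
Proof.
move=> _ _ [A [B [mA mB ->]]] [A' [B' [mA' mB' ->]]].
exists (A `&` A'), (fun i => B i `&` B' i); split.
- exact: measurableI.
- by move=> i; exact: measurableI.
by rewrite setIACA -bigcapI.
Qed.

Lemma measurable_past k : measurable_fun setT (id : Omega -> past k).
Proof.
move=> _ A mA; rewrite setTI preimage_id.
by apply: smallest_sub mA; [exact: sigma_algebra_measurable|exact: past_rect_measurable].
Qed.

Lemma measurable_past_X1 k : measurable_fun setT (X1 : past k -> T1).
Proof.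
move=> _ A mA; apply: sub_sigma_algebra.
exists A, (fun=> setT); split => //.
by rewrite setTI setIidl// => w _ i _.
Qed.

Lemma measurable_past_eps k i : (2 <= i <= k)%N ->
  measurable_fun setT (eps i : past k -> T2).
Proof.
move=> ik _ A mA; apply: sub_sigma_algebra.
exists setT, (fun j => if j == i then A else setT); split => //.
  by move=> j; case: ifP.
apply/seteqP; split => w /=.
  move=> [_ Aw]; split => // j _ /=.
  by case: ifPn => [/eqP ->|].
by move=> [_ /(_ i)]/=; rewrite eqxx => h; split => //; apply: h; rewrite in_past_index.
Qed.

Lemma past_rect_law (J : {fset nat}) A (B : nat -> set T2) :
  (forall i, i \in J -> (2 <= i)%N) -> measurable A ->
  (forall i, measurable (B i)) ->
  P (X1 @^-1` A `&` \bigcap_(i in [set` J]) eps i @^-1` B i) =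
  P (X1 @^-1` A) * \prod_(i <- J) P (eps i @^-1` B i).
Proof.
move=> J2 mA mB; rewrite X1_eps.
- congr (_ * _); apply: iid_eps.1 => // i /J2 /=.
  exact: leq_trans.
- by exists A => //; rewrite setTI.
- rewrite /sigma_family; set G := \bigcup_(i in _) sigma_rv _.
  apply: (@fin_bigcap_measurable _ (g_sigma_algebraType G)) => // i Ji.
  apply: sub_sigma_algebra; exists i => /=; first exact: J2.
  by exists (B i) => //; rewrite setTI.
Qed.

(** Both sides are finite measures in [A]: the restriction of [P] to
    [xi @^-1` B], and [P] scaled by the probability of that event. They agree on
    the pi-system [past_rect k] because a rectangle of the past intersected with
    [xi @^-1` B] is a rectangle of one more coordinate. *)
Lemma independent_past k (xi := eps k.+1) : (1 <= k)%N ->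
  independent_with_law (mfun_Sub (mem_set (@measurable_past k))) xi
    (distribution P (eps 1%N)).
Proof.
move=> k1 A B mA mB.
transitivity (P A * P (xi @^-1` B)); last by congr (_ * _); exact: iid_eps.2.
have mxiB : measurable (xi @^-1` B) by exact: measurable_funPTI.
pose c : {nonneg R} := NngNum (fine_ge0 (measure_ge0 P (xi @^-1` B))).
have xiB : P (xi @^-1` B) = c%:num%:E.
  by rewrite /= fineK// fin_num_measure.
rewrite xiB muleC.
rewrite -[RHS]/(mscale c P A) -[LHS]/(mrestr P mxiB A).
apply: (g_sigma_algebra_measure_unique (past_rect k) _ (fun=> setT)) => //.
- exact: past_rect_measurable.
- move=> _; exists setT, (fun=> setT); split => //.
  by rewrite preimage_setT setIidl// => w _ i _.
- by rewrite bigcup_const//; exists 0%N.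
- exact: past_rectI.
- move=> _ [A' [B' [mA' mB' ->]]].
  rewrite -[LHS]/(P (_ `&` xi @^-1` B)) -[RHS]/(c%:num%:E * P _) -xiB muleC.
  have kN : k.+1 \notin past_index k by rewrite in_past_index ltnn andbF.
  pose B'' i := if i == k.+1 then B else B' i.
  have B''E i : i \in past_index k -> B'' i = B' i.
    by rewrite /B''; case: eqP => // ->; rewrite (negbTE kN).
  transitivity (P (X1 @^-1` A' `&` \bigcap_(i in [set` (k.+1 |` past_index k)%fset])
      eps i @^-1` B'' i)).
    rewrite [in RHS]bigcap_fset big_fsetU1//= /B'' eqxx -/xi -setIA; congr (P (_ `&` _)).
    rewrite setIC bigcap_fset; congr (_ `&` _).
    by rewrite big_seq [RHS]big_seq; apply: eq_bigr => i /B''E; rewrite /B'' => ->.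
  rewrite past_rect_law//; first last.
  - by move=> i; rewrite /B''; case: ifP.
  - by move=> i; rewrite in_fset1U in_past_index => /orP[/eqP ->//|/andP[]].
  rewrite past_rect_law//; last by move=> i; rewrite in_past_index => /andP[].
  rewrite big_fsetU1//= {1}/B'' eqxx -/xi muleA muleAC; congr (_ * _ * _).
  by rewrite big_seq [RHS]big_seq; apply: eq_bigr => i /B''E ->.
- by move=> _; rewrite /mrestr/= (le_lt_trans (probability_le1 _ _))// ?ltry// setTI.
Qed.

End past.

(** * Centring a Lipschitz function of one variable *)

Section mean_dist.
Context {R : realType} (S : completeMetricType R) (sepS : separable S).
Context (mu : probability (borel S) R) (c : R) (c0 : 0 <= c).

Lemma measurable_scaled_mdist x :
  measurable_fun setT (fun x' : borel S => (c * mdist x x')%:E).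
Proof.
apply/measurable_EFinP; apply: measurable_funM => //; exact: measurable_mdist.
Qed.

Lemma mean_dist_ge0 x : (0 <= mean_dist mu c x)%E.
Proof.
by apply: integral_ge0 => y _; rewrite lee_fin mulr_ge0// mdist_ge0.
Qed.

Lemma mean_dist_triangle x y :
  (mean_dist mu c x <= (c * mdist x y)%:E + mean_dist mu c y)%E.
Proof.
have cd0 z x' : (0 <= (c * mdist z x')%:E)%E.
  by rewrite lee_fin mulr_ge0// mdist_ge0.
rewrite -[((c * mdist x y)%:E)%E]mule1 -(@probability_setT _ _ _ mu).
rewrite -integral_cst// -ge0_integralD//; last exact: measurable_scaled_mdist.
  2: by move=> z _; exact: cd0.
apply: ge0_le_integral => //.
- exact: measurable_scaled_mdist.
- by apply: emeasurable_funD => //; exact: measurable_scaled_mdist.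
- by move=> z _ /=; rewrite -EFinD lee_fin -mulrDr ler_wpM2l// metric_triangle.
Qed.

(** By the triangle inequality [mean_dist] is either finite everywhere or
    infinite everywhere, and the latter contradicts the moment bound. *)
Lemma mean_dist_lty d (T : measurableType d) (Q : probability T R)
    (Y : T -> S) (V : R) :
  (\int[Q]_w (mean_dist mu c (Y w) ^+ 2) <= V%:E)%E ->
  forall x, (mean_dist mu c x < +oo)%E.
Proof.
move=> QV x; rewrite ltey; apply: contraPN QV => /eqP Gx.
have Gy y : mean_dist mu c y = +oo%E.
  have := mean_dist_triangle x y; rewrite Gx leye_eq.
  by case: (mean_dist mu c y) (mean_dist_ge0 y) => //.
under eq_integral do rewrite Gy.
apply/negP; rewrite -ltNge (_ : \int[Q]_w _ = +oo)%E ?ltry//.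
have -> : ((+oo : \bar R) ^+ 2 = +oo)%E by rewrite expe2 mulyy.
by rewrite integral_cst//= probability_setT mule1.
Qed.

Context (Gfin : forall x, (mean_dist mu c x < +oo)%E).

Lemma mean_dist_fineK x : ((fine (mean_dist mu c x))%:E = mean_dist mu c x)%E.
Proof. by rewrite fineK// ge0_fin_numE// mean_dist_ge0. Qed.

Lemma measurable_mean_dist :
  measurable_fun setT (mean_dist mu c : borel S -> \bar R).
Proof.
rewrite (_ : mean_dist mu c = EFin \o (fine \o mean_dist mu c)); last first.
  by apply/funext => x /=; rewrite mean_dist_fineK.
apply/measurable_EFinP; apply: (measurable_lipschitz sepS c0) => x x'.
have tri y z := mean_dist_triangle y z.
rewrite /= ler_distl lerBlDr addrC; apply/andP; split.
  have := tri x' x; rewrite -(mean_dist_fineK x) -(mean_dist_fineK x') -EFinD lee_fin.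
  by rewrite metric_sym.
by have := tri x x'; rewrite -(mean_dist_fineK x) -(mean_dist_fineK x') -EFinD lee_fin addrC.
Qed.

Lemma integrable_scaled_mdist x :
  mu.-integrable setT (fun x' : borel S => (c * mdist x x')%:E).
Proof.
apply/integrableP; split; first exact: measurable_scaled_mdist.
under eq_integral do rewrite gee0_abs ?lee_fin ?mulr_ge0 ?mdist_ge0//.
exact: Gfin.
Qed.

(** Each step of the martingale decomposition replaces [h] by [h] minus its mean,
    for some Lipschitz [h]. Writing this as the average of [h x - h x'] over
    [x'] bounds it by a multiple of [mean_dist]. *)
Section centering.
Context (h : S -> R) (K : R) (K0 : 0 <= K)
  (lip : forall x x', `|h x - h x'| <= K * (c * mdist x x')).

Let m := fine (\int[mu]_x (h x)%:E)%E.

Let mh : measurable_fun setT (h : borel S -> R).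
Proof.
apply: (@measurable_lipschitz _ _ h (K * c)) => // [|x x'].
  exact: mulr_ge0.
by rewrite -mulrA.
Qed.

Lemma integrable_lipschitz : mu.-integrable setT (EFin \o h).
Proof.
pose g x := (`|h point|)%:E + (K%:E * (c * mdist (point : S) x)%:E)%E.
apply: (@le_integrable _ (borel S) _ mu _ _ _ g) => //.
- exact/measurable_EFinP.
- move=> x _; rewrite /g -EFinM -EFinD lee_fin.
  have hx := lip x point; rewrite [leRHS]ger0_norm; last first.
    by rewrite addr_ge0// !mulr_ge0// mdist_ge0.
  rewrite -lerBlDl; apply: le_trans (lerB_dist _ _) _.
  by rewrite metric_sym.
- apply: integrableD => //.
    exact: (finite_measure_integrable_cst mu `|h point|).
  by apply: integrableZl => //; exact: integrable_scaled_mdist.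
Qed.

Let mE : (m%:E = \int[mu]_x (h x)%:E)%E.
Proof. by rewrite /m fineK// integrable_fin_num//; exact: integrable_lipschitz. Qed.

Lemma integrable_centered : mu.-integrable setT (fun x => (h x - m)%:E).
Proof.
under eq_fun do rewrite EFinB.
apply: integrableB => //; first exact: integrable_lipschitz.
exact: finite_measure_integrable_cst.
Qed.

Lemma integral_centered : (\int[mu]_x (h x - m)%:E = 0)%E.
Proof.
under eq_integral do rewrite EFinB.
rewrite integralB//; [|exact: integrable_lipschitz|exact: finite_measure_integrable_cst].
by rewrite integral_cst//= probability_setT mule1 mE subee// -mE.
Qed.

Lemma centered_le x : ((`|h x - m|)%:E <= K%:E * mean_dist mu c x)%E.
Proof.
have ihx : mu.-integrable setT (fun y => (h x - h y)%:E).
  under eq_fun do rewrite EFinB.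
  apply: integrableB => //; last exact: integrable_lipschitz.
  exact: finite_measure_integrable_cst.
rewrite -[X in (X <= _)%E]/(`|(h x - m)%:E|)%E.
have -> : ((h x - m)%:E = \int[mu]_y (h x - h y)%:E)%E.
  under eq_integral do rewrite EFinB.
  rewrite integralB//; [|exact: finite_measure_integrable_cst|exact: integrable_lipschitz].
  by rewrite integral_cst//= probability_setT mule1 -mE EFinB.
apply: (@le_trans _ _ (\int[mu]_y `|(h x - h y)%:E|)%E).
  by apply: le_abse_integral => //; exact: measurable_int ihx.
rewrite -ge0_integralZl//; last 2 first.
- exact: measurable_scaled_mdist.
- by move=> y _; rewrite lee_fin mulr_ge0// mdist_ge0.
apply: ge0_le_integral => //.
- by apply: measurableT_comp => //; exact: measurable_int ihx.
- by apply: measurable_funeM; exact: measurable_scaled_mdist.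
- by move=> y _; rewrite -EFinM lee_fin lip.
Qed.

Lemma centered_sqr_le (V : R) :
  (\int[mu]_x (mean_dist mu c x ^+ 2) <= V%:E)%E ->
  (\int[mu]_x ((h x - m) ^+ 2)%:E <= (K ^+ 2 * V)%:E)%E.
Proof.
move=> GV; rewrite EFinM.
apply: (@le_trans _ _ ((K ^+ 2)%:E * \int[mu]_x (mean_dist mu c x ^+ 2))%E).
  have mG2 : measurable_fun setT (fun x : borel S => (mean_dist mu c x ^+ 2)%E).
    under eq_fun do rewrite expe2.
    by apply: emeasurable_funM; exact: measurable_mean_dist.
  rewrite -ge0_integralZl//; last 2 first.
  - by move=> x _; rewrite expe2 mule_ge0// mean_dist_ge0.
  - by rewrite lee_fin sqr_ge0.
  apply: ge0_le_integral => //.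
  - by move=> x _; rewrite lee_fin sqr_ge0.
  - apply/measurable_EFinP; apply: measurable_funX.
    by apply: measurable_funB.
  - exact: measurable_funeM.
  - move=> x _; have := centered_le x.
    rewrite -mean_dist_fineK -EFin_expe -!EFinM !lee_fin -exprMn => hx.
    by rewrite -real_normK ?num_real// lerXn2r// nnegrE (le_trans _ hx).
by rewrite lee_wpmul2l// lee_fin sqr_ge0.
Qed.

End centering.
End mean_dist.

(** * The martingale decomposition of a Lipschitz functional *)

Lemma integrable_comp_distribution d d' (Omega : measurableType d)
    (T : measurableType d') (R : realType) (P : probability Omega R)
    (X : {RV P >-> T}) (g : T -> \bar R) :
  (distribution P X).-integrable setT g -> P.-integrable setT (g \o X).
Proof.
move=> /integrableP[mg ig]; apply/integrableP; split.
  exact: (measurableT_comp mg).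
rewrite -[X in (X < _)%E](@ge0_integral_distribution _ _ _ _ _ P X (abse \o g))//.
  exact: (measurableT_comp _ mg).
by move=> y; exact: abse_ge0.
Qed.

Section geomsum.
Context (R : realType) (rho : R).

Lemma geomsum0 : geomsum rho 0 = 1.
Proof. by rewrite /geomsum big_nat1 expr0. Qed.

Lemma geomsumS k : geomsum rho k.+1 = 1 + rho * geomsum rho k.
Proof.
rewrite /geomsum big_nat_recl//= expr0 mulr_sumr; congr (_ + _).
by apply: eq_bigr => i _; rewrite exprS.
Qed.

Lemma geomsum_ge0 k : 0 <= rho -> 0 <= geomsum rho k.
Proof. by move=> rho0; apply: sumr_ge0 => i _; exact: exprn_ge0. Qed.

End geomsum.

Section chain.
Context (R : realType) (d : measure_display) (Omega : measurableType d)
  (P : probability Omega R) (SX SY : completeMetricType R)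
  (sepX : separable SX) (sepY : separable SY)
  (eps : nat -> {RV P >-> borel SY}) (X : nat -> {RV P >-> borel SX})
  (F : borel SX * borel SY -> borel SX) (rho C V1 V2 : R).

Context (iid_eps : iid [set i | (1 <= i)%N] eps)
  (X1_eps : independent_systems P (sigma_rv (X 1%N))
    (sigma_family [set i | (2 <= i)%N] eps))
  (mF : measurable_fun setT F)
  (recX : forall k, (2 <= k)%N -> forall w, X k w = F (X k.-1 w, eps k w))
  (rho0 : 0 <= rho) (C0 : 0 < C)
  (contractF : forall x x' : SX,
    (\int[P]_w (mdist (F (x, eps 1%N w) : SX) (F (x', eps 1%N w)))%:E
      <= (rho * mdist x x')%:E)%E)
  (lipF : forall (x : SX) (y y' : SY),
    mdist (F (x, y) : SX) (F (x, y')) <= C * mdist y y')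
  (GX_V1 : (\int[P]_w (mean_dist (distribution P (X 1%N)) 1 (X 1%N w) ^+ 2)
    <= V1%:E)%E)
  (Geps_V2 : (\int[P]_w (mean_dist (distribution P (eps 1%N)) C (eps 1%N w) ^+ 2)
    <= V2%:E)%E).

Let nu := distribution P (eps 1%N).
Let GX := mean_dist (distribution P (X 1%N)) 1.
Let Geps := mean_dist nu C.
Let K := geomsum rho.
Let K0 k : 0 <= K k. Proof. exact: geomsum_ge0. Qed.
Let C_ge0 : 0 <= C. Proof. exact: ltW. Qed.

Let GXfin x : (GX x < +oo)%E.
Proof. exact: mean_dist_lty GX_V1 x. Qed.

Let Gepsfin y : (Geps y < +oo)%E.
Proof. exact: mean_dist_lty Geps_V2 y. Qed.

Definition extend (k : nat) (x : nat -> SX) (y : SY) : nat -> SX :=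
  [eta x with k |-> (F (x k.-1, y) : SX)].

Lemma extend_eq k x y : extend k x y k = F (x k.-1, y).
Proof. by rewrite /extend/= eqxx. Qed.

Lemma extend_neq k x y i : (i < k)%N -> extend k x y i = x i.
Proof. by move=> ik; rewrite /extend/= ltn_eqF. Qed.

Lemma measurable_mdist_F x x' : measurable_fun setT
  (fun y : borel SY => (mdist (F (x, y) : SX) (F (x', y)))%:E).
Proof.
apply/measurable_EFinP.
apply: (@measurable_lipschitz _ SY (fun y => mdist (F (x, y) : SX) (F (x', y))) (C + C)) => //.
  by rewrite addr_ge0.
move=> y y'; rewrite mulrDl ler_distl lerBlDr.
have h1 := lipF x y y'; have h2 := lipF x' y y'.
have t1 := metric_triangle (F (x, y) : SX) (F (x, y')) (F (x', y)).
have t2 := metric_triangle (F (x, y') : SX) (F (x', y')) (F (x', y)).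
have t3 := metric_triangle (F (x, y') : SX) (F (x, y)) (F (x', y')).
have t4 := metric_triangle (F (x, y) : SX) (F (x', y)) (F (x', y')).
rewrite (metric_sym (F (x', y') : SX)) in t2.
rewrite (metric_sym (F (x, y') : SX) (F (x, y))) in t3.
by apply/andP; split; lra.
Qed.

Lemma contract_nu x x' : (\int[nu]_y (mdist (F (x, y) : SX) (F (x', y)))%:E
  <= (rho * mdist x x')%:E)%E.
Proof.
rewrite ge0_integral_distribution//=; last by move=> y; rewrite lee_fin mdist_ge0.
exact: measurable_mdist_F.
Qed.

Context (n : nat) (f : ('I_n -> SX) -> R) (lipf : lipschitz1 f).

(** [value j x] is the conditional expectation of [f (X 1, ..., X n)] given that
    the chain has followed [x] up to time [n - j], built by integrating the
    innovations out backwards; it only depends on the first [n - j] coordinates. *)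
Fixpoint value (j : nat) (x : nat -> SX) : R :=
  if j is j'.+1 then fine (\int[nu]_y (value j' (extend (n - j') x y))%:E)%E
  else f (fun i : 'I_n => x i.+1).

(** The last coordinate has a larger Lipschitz constant because the chain is
    restarted from it: a perturbation there propagates through the [j] remaining
    steps, contracted by [rho] at each of them, and so costs
    [1 + rho + ... + rho ^ j]. *)
Definition value_lip j := forall x x',
  `|value j x - value j x'| <=
    \sum_(1 <= i < n - j) mdist (x i) (x' i) + K j * mdist (x (n - j)%N) (x' (n - j)%N).

Lemma value_lip_extend j x y y' : value_lip j ->
  `|value j (extend (n - j) x y) - value j (extend (n - j) x y')| <=
    K j * (C * mdist y y').
Proof.
move=> /(_ (extend (n - j) x y) (extend (n - j) x y')) /le_trans; apply.
rewrite big_nat big1 ?add0r; last first.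
  by move=> i /andP[_ ij]; rewrite !extend_neq// mdistxx.
by rewrite !extend_eq ler_wpM2l.
Qed.

Lemma integrable_value_extend j x : value_lip j ->
  nu.-integrable setT (fun y : borel SY => (value j (extend (n - j) x y))%:E).
Proof.
move=> lipj; apply: (integrable_lipschitz sepY C_ge0 Gepsfin (K0 j)) => y y'.
exact: value_lip_extend.
Qed.

(** Integrating out the innovation at time [m.+1] moves the weight [K j] of that
    coordinate, times [rho], onto coordinate [m], whose own weight is [1]; and
    [1 + rho * K j = K j.+1]. *)
Lemma value_lipschitz j : (j < n)%N -> value_lip j.
Proof.
elim: j => [|j IHj] jn x x'.
  rewrite subn0 /K geomsum0 mul1r; apply: le_trans (lipf _ _) _.
  rewrite -(big_mkord xpredT (fun i => mdist (x i.+1) (x' i.+1))).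
  by rewrite -(big_add1 _ _ 0 n.+1 xpredT (fun i => mdist (x i) (x' i)))
    big_nat_recr.
have lipj := IHj (ltnW jn).
have [m m0 njE] : exists2 m, (0 < m)%N & (n - j = m.+1)%N.
  by exists (n - j.+1)%N; [rewrite subn_gt0|rewrite subnSK// (ltnW jn)].
have -> : (n - j.+1 = m)%N by rewrite subnS njE.
have i1 := integrable_value_extend x lipj; have i2 := integrable_value_extend x' lipj.
rewrite -lee_fin /=.
have -> : (`|fine (\int[nu]_y (value j (extend (n - j) x y))%:E) -
   fine (\int[nu]_y (value j (extend (n - j) x' y))%:E)|%:E =
   `|\int[nu]_y ((value j (extend (n - j) x y))%:E - (value j (extend (n - j) x' y))%:E)|)%E.
  rewrite integralB// -(fineK (integrable_fin_num measurableT i1)).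
  by rewrite -(fineK (integrable_fin_num measurableT i2)).
have iB := integrableB measurableT i1 i2.
apply: (le_trans (le_abse_integral _ _ _)) => //.
  exact: measurable_int iB.
set s := \sum_(1 <= i < m.+1) mdist (x i) (x' i).
have mFd : measurable_fun setT
    (fun y : borel SY => (mdist (F (x m, y) : SX) (F (x' m, y)))%:E).
  exact: measurable_mdist_F.
apply: (@le_trans _ _ (\int[nu]_y (s%:E + (K j)%:E * (mdist (F (x m, y) : SX) (F (x' m, y)))%:E)))%E.
  apply: ge0_le_integral => //.
  - by apply: measurableT_comp => //; exact: measurable_int iB.
  - by apply: emeasurable_funD => //; exact: measurable_funeM.
  - move=> y _; rewrite -EFinB -EFinM -EFinD lee_fin.
    apply: (le_trans (lipj _ _)); rewrite njE !extend_eq lerD2r /s.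
    rewrite big_nat [leRHS]big_nat ler_sum// => i /andP[_ im].
    by rewrite !extend_neq// njE.
rewrite ge0_integralD//; last first.
- by apply: measurable_funeM.
- by move=> y _; rewrite -EFinM lee_fin mulr_ge0// mdist_ge0.
- by move=> y _; rewrite lee_fin sumr_ge0// => i _; exact: mdist_ge0.
rewrite integral_cst//= probability_setT mule1 ge0_integralZl//; last first.
- by rewrite lee_fin.
- by move=> y _; rewrite lee_fin mdist_ge0.
apply: (@le_trans _ _ (s%:E + (K j)%:E * (rho * mdist (x m) (x' m))%:E)%E).
  by rewrite leeD2l// lee_wpmul2l ?lee_fin//; exact: contract_nu.
rewrite -EFinM -EFinD lee_fin /s big_nat_recr//= [K j.+1]geomsumS -/(K j).
lra.
Qed.

Context (n_gt0 : (1 <= n)%N).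

Let traj w : nat -> SX := X^~ w.
Let past k := past (X 1%N) eps k.

Lemma value_lipschitz_sum j x x' : (j < n)%N ->
  `|value j x - value j x'| <=
    (1 + K j) * \sum_(i <- index_iota 1 (n - j).+1) mdist (x i) (x' i).
Proof.
move=> jn; apply: (le_trans (value_lipschitz jn x x')).
have nj : (1 <= n - j)%N by rewrite subn_gt0.
rewrite big_nat_recr//=.
have s0 : 0 <= \sum_(1 <= i < n - j) mdist (x i) (x' i).
  by apply: sumr_ge0 => i _; exact: mdist_ge0.
have d0 : 0 <= mdist (x (n - j)%N) (x' (n - j)%N) by exact: mdist_ge0.
have : 0 <= K j * \sum_(1 <= i < n - j) mdist (x i) (x' i) by exact: mulr_ge0.
by rewrite mulrDl mul1r mulrDr; lra.
Qed.

Lemma measurable_past_chain i m : (1 <= i <= m)%N ->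
  measurable_fun setT (X i : past m -> borel SX).
Proof.
case: i => // i /andP[_]; elim: i => [_|i IHi im].
  exact: measurable_past_X1.
rewrite (_ : X i.+2 = F \o (fun w => (X i.+1 w, eps i.+2 w)) :> (_ -> _)).
  apply: (measurableT_comp mF); apply: measurable_fun_pair.
    exact: IHi (ltnW im).
  exact: measurable_past_eps.
by apply/funext => w; exact: recX.
Qed.

Lemma measurable_value_traj k m : (1 <= k <= m)%N -> (k <= n)%N ->
  measurable_fun setT ((fun w => value (n - k) (traj w)) : past m -> R).
Proof.
move=> /andP[k1 km] kn.
have nkn : (n - k < n)%N by rewrite ltn_subrL k1.
apply: (@measurable_lipschitz_seq _ _ _ (past m) (value (n - k)) (1 + K (n - k))
  (index_iota 1 k.+1) (fun i w => X i w)) => //.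
- by rewrite addr_ge0.
- by move=> x x'; have := value_lipschitz_sum x x' nkn; rewrite subKn.
- move=> i; rewrite mem_index_iota ltnS => /andP[i1 ik].
  by apply: measurable_past_chain; rewrite i1 (leq_trans ik).
Qed.

(** The [k]-th martingale increment as a function of the past and of the value
    [z.2] of the innovation at time [k]; it depends on [z.1] only
    through [X 1, ..., X k.-1]. *)
Definition next_incr k (z : Omega * SY) : R :=
  value (n - k) (extend k (traj z.1) z.2) - value (n - k).+1 (traj z.1).

Lemma measurable_next_incr k : (1 <= k < n)%N ->
  measurable_fun setT (next_incr k.+1 : past k * borel SY -> R).
Proof.
move=> /andP[k1 kn]; apply: measurable_funB; last first.
  rewrite -subSn// subSS.
  apply: (measurableT_comp (f := (fun w => value (n - k) (traj w)) : past k -> R)).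
    by apply: measurable_value_traj; rewrite ?k1 ?leqnn// ltnW.
  exact: measurable_fst.
have nkn : (n - k.+1 < n)%N by rewrite ltn_subrL.
apply: (@measurable_lipschitz_seq _ _ _ (past k * borel SY)%type (value (n - k.+1))
  (1 + K (n - k.+1)) (index_iota 1 k.+2)
  (fun i z => extend k.+1 (traj z.1) z.2 i)) => //.
- by rewrite addr_ge0.
- by move=> x x'; have := value_lipschitz_sum x x' nkn; rewrite subKn.
- move=> i; rewrite mem_index_iota ltnS => /andP[i1]; rewrite leq_eqVlt => /predU1P[->|ik].
    rewrite (_ : (fun z => _) = F \o (fun z : past k * borel SY => (X k z.1, z.2))).
      apply: (measurableT_comp mF); apply: measurable_fun_pair => //.
      apply: (measurableT_comp (f := X k : past k -> borel SX)) => //.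
      by apply: measurable_past_chain; rewrite k1 leqnn.
    by apply/funext => z; rewrite extend_eq.
  rewrite (_ : (fun z => _) = (X i : past k -> borel SX) \o fst).
    apply: measurableT_comp => //.
    by apply: measurable_past_chain; rewrite i1.
  by apply/funext => z; rewrite extend_neq.
Qed.

Let next_incrE k w y : (k <= n)%N -> next_incr k (w, y) =
  value (n - k) (extend k (traj w) y) -
  fine (\int[nu]_y (value (n - k) (extend k (traj w) y))%:E)%E.
Proof. by move=> kn; rewrite /next_incr/= subKn. Qed.

Let lip_next k : (1 <= k <= n)%N -> forall x y y',
  `|value (n - k) (extend k x y) - value (n - k) (extend k x y')|
    <= K (n - k) * (C * mdist y y').
Proof.
move=> /andP[k1 kn] x y y'.
have nkn : (n - k < n)%N by rewrite ltn_subrL k1.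
by have := value_lip_extend x y y' (value_lipschitz nkn); rewrite subKn.
Qed.

Lemma integrable_next_incr k w : (1 <= k <= n)%N ->
  nu.-integrable setT (fun y : borel SY => (next_incr k (w, y))%:E).
Proof.
move=> kn; under eq_fun do rewrite next_incrE ?(andP kn).2//.
exact: (integrable_centered sepY C_ge0 Gepsfin (K0 _) (lip_next kn (traj w))).
Qed.

Lemma integral_next_incr k w : (1 <= k <= n)%N ->
  (\int[nu]_y (next_incr k (w, y))%:E = 0)%E.
Proof.
move=> kn; under eq_integral do rewrite next_incrE ?(andP kn).2//.
exact: (integral_centered sepY C_ge0 Gepsfin (K0 _) (lip_next kn (traj w))).
Qed.

Lemma next_incr_le k w y : (1 <= k <= n)%N ->
  ((`|next_incr k (w, y)|)%:E <= (K (n - k))%:E * Geps y)%E.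
Proof.
move=> kn; rewrite next_incrE ?(andP kn).2//.
exact: (centered_le sepY C_ge0 Gepsfin (K0 _) (lip_next kn (traj w))).
Qed.

Lemma next_incr_sqr k w : (1 <= k <= n)%N ->
  (\int[nu]_y (next_incr k (w, y) ^+ 2)%:E <= (K (n - k) ^+ 2 * V2)%:E)%E.
Proof.
move=> kn; under eq_integral do rewrite next_incrE ?(andP kn).2//.
apply: (centered_sqr_le sepY C_ge0 Gepsfin (K0 _) (lip_next kn (traj w))).
rewrite ge0_integral_distribution//.
  under eq_fun do rewrite expe2.
  by apply: emeasurable_funM; exact: measurable_mean_dist.
by move=> y; rewrite expe2 mule_ge0// mean_dist_ge0.
Qed.

(** [value n.-1] depends on the first coordinate only, so the
    constant sequence may stand for any sequence that starts with [x]. *)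
Definition value1 (x : SX) : R := value n.-1 (fun=> x).

Definition mean_value : R := fine (\int[distribution P (X 1%N)]_x (value1 x)%:E)%E.

Let n1n : (n.-1 < n)%N. Proof. by rewrite ltn_predL. Qed.

Let nn1 : (n - n.-1 = 1)%N. Proof. by rewrite -[in LHS](prednK n_gt0) subSnn. Qed.

Lemma value1_traj w : value n.-1 (traj w) = value1 (X 1%N w).
Proof.
have := value_lipschitz n1n (traj w) (fun=> X 1%N w).
rewrite nn1 big_geq// add0r mdistxx mulr0 normr_le0 subr_eq0.
by move/eqP.
Qed.

Let lip_value1 x x' : `|value1 x - value1 x'| <= K n.-1 * (1 * mdist x x').
Proof.
have := value_lipschitz n1n (fun=> x) (fun=> x').
by rewrite nn1 big_geq// add0r mul1r.
Qed.

Let measurable_value1 : measurable_fun setT (value1 : borel SX -> R).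
Proof.
apply: (measurable_lipschitz sepX (K0 n.-1)) => x x'.
by have := lip_value1 x x'; rewrite mul1r.
Qed.

Definition incr k w : R :=
  if k == 1%N then value1 (X 1%N w) - mean_value else next_incr k (w, eps k w).

Lemma incrS k w : (k.+2 <= n)%N ->
  incr k.+2 w = value (n - k.+2) (traj w) - value (n - k.+1) (traj w).
Proof.
move=> kn; rewrite /incr /next_incr/=.
have -> : extend k.+2 (traj w) (eps k.+2 w) = traj w.
  apply/funext => i; rewrite /extend/=; case: eqP => // ->.
  by rewrite /traj (@recX k.+2).
by rewrite -[(n - k.+1)%N]subSS subSn.
Qed.

Lemma sum_incr m w : (1 <= m <= n)%N ->
  \sum_(1 <= k < m.+1) incr k w = value (n - m) (traj w) - mean_value.
Proof.
case: m => // m /andP[_]; elim: m => [_|m IHm mn].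
  by rewrite big_nat1 /incr eqxx -value1_traj subn1.
rewrite big_nat_recr//= IHm ?(ltnW mn)// incrS//.
by rewrite addrC addrA subrK.
Qed.

Let Z k := mfun_Sub (mem_set (@measurable_past _ _ _ _ _ _ _ P (X 1%N) eps k)).

Let indepZ k : (1 <= k)%N -> independent_with_law (Z k) (eps k.+1) nu.
Proof. exact: independent_past. Qed.

(** For [k >= 2] integrability comes from the second moment, which is computed by
    freezing the past and integrating the innovation. *)
Lemma integrable_incr k : (1 <= k <= n)%N ->
  P.-integrable setT (fun w => (incr k w)%:E).
Proof.
case: k => // -[_|k kn].
  rewrite /incr eqxx.
  apply: (integrable_comp_distribution (P := P) (X := X 1%N)
    (g := fun x => (value1 x - mean_value)%:E)).
  exact: (integrable_centered sepX ler01 GXfin (K0 _) lip_value1).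
have kn' : (1 <= k.+1 < n)%N by case/andP: kn.
have mD := measurable_next_incr kn'.
have mincr : measurable_fun setT (incr k.+2).
  rewrite /incr/=; apply: (measurableT_comp mD (f := next_incr k.+2 : past k.+1 * borel SY -> R)).
  exact: (measurable_fun_pair (f := Z k.+1)).
have sqr : (\int[P]_w (incr k.+2 w ^+ 2)%:E <= (K (n - k.+2) ^+ 2 * V2)%:E)%E.
  rewrite (ge0_integral_independent (indepZ (ltn0Sn k))
    (f := fun z => (next_incr k.+2 z ^+ 2)%:E)); last 2 first.
  - by apply/measurable_EFinP; exact: measurable_funX.
  - by move=> z; rewrite lee_fin sqr_ge0.
  rewrite -[leRHS]mule1 -(@probability_setT _ _ _ P) -integral_cst//.
  apply: ge0_le_integral => //.
  - by move=> w _; apply: integral_ge0 => y _; rewrite lee_fin sqr_ge0.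
  - apply: (measurableT_comp (f := fun w : past k.+1 =>
      \int[nu]_y (next_incr k.+2 (w, y) ^+ 2)%:E)%E); last by [].
    apply: (@measurable_fun_fubini_tonelli_F _ _ _ _ _ nu
      (fun z : past k.+1 * borel SY => (next_incr k.+2 z ^+ 2)%:E)).
      by apply/measurable_EFinP; exact: measurable_funX.
    by move=> z; rewrite lee_fin sqr_ge0.
  - by move=> w _; exact: next_incr_sqr.
apply: (@le_integrable _ _ _ P _ _ _ (fun w => 1 + (incr k.+2 w ^+ 2)%:E)%E) => //.
- exact/measurable_EFinP.
- move=> w _; rewrite -EFinD lee_fin [leRHS]ger0_norm ?addr_ge0 ?sqr_ge0//.
  rewrite -(real_normK (num_real (incr k.+2 w))).
  have := sqr_ge0 (`|incr k.+2 w| - 1); have := normr_ge0 (incr k.+2 w).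
  nra.
- apply: integrableD => //; first exact: (finite_measure_integrable_cst P 1).
  apply/integrableP; split; first by apply/measurable_EFinP; exact: measurable_funX.
  under eq_integral do rewrite gee0_abs ?lee_fin ?sqr_ge0//.
  by rewrite (le_lt_trans sqr)// ltry.
Qed.

Lemma integral_incr k : (1 <= k <= n)%N -> (\int[P]_w (incr k w)%:E = 0)%E.
Proof.
case: k => // -[_|k kn].
  rewrite /incr eqxx.
  rewrite -(integral_distribution (P := P) (X := X 1%N)
    (f := fun x => (value1 x - mean_value)%:E)).
  - exact: (integral_centered sepX ler01 GXfin (K0 _) lip_value1).
  - by apply/measurable_EFinP; exact: measurable_funB.
  - by have := integrable_incr (k := 1); rewrite /incr eqxx; exact.
have kn' : (1 <= k.+1 < n)%N by case/andP: kn.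
rewrite (integral_independent (indepZ (ltn0Sn k)) (f := fun z => (next_incr k.+2 z)%:E)).
- by rewrite integral0_eq// => w _; exact: integral_next_incr.
- by apply/measurable_EFinP; exact: measurable_next_incr.
- exact: (integrable_incr kn).
Qed.

(** The random variables whose maximum is the variable [M] of the theorem: each
    dominates the increment with the same index and is a function of the [k]-th
    independent source of randomness alone. *)
Definition incr_bound k w : \bar R :=
  ((K (n - k))%:E * (if k == 1%N then GX (X 1%N w) else Geps (eps k w)))%E.

Lemma incr_le k w : (1 <= k <= n)%N -> ((`|incr k w|)%:E <= incr_bound k w)%E.
Proof.
move=> kn; rewrite /incr /incr_bound; case: eqP => [->|_]; last exact: next_incr_le.
by rewrite subn1; exact: (centered_le sepX ler01 GXfin (K0 _) lip_value1).
Qed.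

(** A deterministic bound for the conditional variance of the [k]-th
    increment. *)
Definition incr_var k : R := K (n - k) ^+ 2 * (if k == 1%N then V1 else V2).

Let psum l y m w := \sum_(1 <= k < m.+1) l * Num.min (incr k w) y.

Let measurable_psum l y m : (1 <= m <= n)%N ->
  measurable_fun setT (psum l y m : past m -> R).
Proof.
move=> /andP[m1 mn]; rewrite /psum.
rewrite (_ : (fun w => _) = fun w => \sum_(1 <= k < m.+1)
    l * Num.min (if (1 <= k <= m)%N then incr k w else 0) y); last first.
  by apply/funext => w; apply: eq_big_nat => k; rewrite ltnS => ->.
apply: measurable_sum => k; apply: measurable_funM => //; apply: measurable_minr => //.
case: (boolP (1 <= k <= m)%N) => // /andP[k1 km]; case: k k1 km => // -[_ _|k _ km].
  rewrite /incr eqxx; apply: measurable_funB => //.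
  by apply: measurableT_comp => //; exact: measurable_past_X1.
rewrite (_ : incr k.+2 = fun w => value (n - k.+2) (traj w) - value (n - k.+1) (traj w)).
  apply: measurable_funB; apply: measurable_value_traj.
  - by rewrite km.
  - exact: leq_trans km mn.
  - by rewrite /= ltnW.
  - exact: leq_trans (ltnW km) mn.
by apply/funext => w; rewrite incrS// (leq_trans km).
Qed.

(** The exponential supermartingale argument: the increments are integrated out
    one at a time, the most recent first. *)
Lemma expR_psum_le l y m : 0 <= l -> 0 <= y -> (1 <= m <= n)%N ->
  (\int[P]_w (expR (psum l y m w))%:E <=
   (expR (l ^+ 2 * expR (l * y) * \sum_(1 <= k < m.+1) incr_var k))%:E)%E.
Proof.
move=> l0 y0; case: m => // m /andP[_]; elim: m => [_|m IHm mn].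
  rewrite /psum; under eq_integral do rewrite big_nat1 /incr eqxx.
  rewrite big_nat1 /incr_var eqxx subn1.
  have mG2 : measurable_fun setT (fun x : borel SX => (GX x ^+ 2)%E).
    under eq_fun do rewrite expe2.
    by apply: emeasurable_funM; exact: measurable_mean_dist.
  rewrite -(ge0_integral_distribution (P := P) (X 1%N)
    (f := fun x => (expR (l * Num.min (value1 x - mean_value) y))%:E)); last 2 first.
  - apply/measurable_EFinP; apply: measurableT_comp => //.
    apply: measurable_funM => //; apply: measurable_minr => //.
    exact: measurable_funB.
  - by move=> x; rewrite lee_fin expR_ge0.
  apply: mgf_truncated => //.
  - exact: (integrable_centered sepX ler01 GXfin (K0 _) lip_value1).
  - exact: (integral_centered sepX ler01 GXfin (K0 _) lip_value1).
  - apply: (centered_sqr_le sepX ler01 GXfin (K0 _) lip_value1).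
    rewrite ge0_integral_distribution// => x.
    by rewrite expe2 mule_ge0// mean_dist_ge0.
have mn' : (1 <= m.+1 < n)%N by [].
rewrite /psum; under eq_integral do rewrite big_nat_recr//= expRD.
rewrite [in leRHS]big_nat_recr//= mulrDr expRD EFinM muleC.
have step := mgf_independent_step (indepZ (ltn0Sn m)) l0 y0
  (Y := fun w => expR (psum l y m.+1 w)) (D := next_incr m.+2)
  (v := K (n - m.+2) ^+ 2 * V2).
apply: le_trans (step _ _ _ _ _ _) _.
- apply: measurableT_comp => //.
  by apply: measurable_psum; rewrite /= ltnW.
- by move=> w; rewrite expR_ge0.
- exact: measurable_next_incr.
- by move=> w; apply: integrable_next_incr.
- by move=> w; apply: integral_next_incr.
- by move=> w; apply: next_incr_sqr.
by rewrite lee_wpmul2l ?lee_fin ?expR_ge0//; exact: IHm (ltnW mn).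
Qed.

Let fX w := f (fun i : 'I_n => X i.+1 w).

Let V := \sum_(1 <= k < n.+1) incr_var k.

Let fXE w : fX w = \sum_(1 <= k < n.+1) incr k w + mean_value.
Proof. by rewrite sum_incr ?n_gt0 ?leqnn// subnn subrK. Qed.

Let sum_incr_centered m : (m <= n)%N ->
  P.-integrable setT (fun w => (\sum_(1 <= k < m.+1) incr k w)%:E) /\
  (\int[P]_w (\sum_(1 <= k < m.+1) incr k w)%:E = 0)%E.
Proof.
elim: m => [_|m IHm mn].
  under eq_fun do rewrite big_geq//.
  split; first exact: integrable0.
  by rewrite integral0.
have [iS S0] := IHm (ltnW mn).
have im := integrable_incr (k := m.+1) mn; have im0 := integral_incr (k := m.+1) mn.
under eq_fun do rewrite big_nat_recr//= EFinD.
split; first exact: integrableD.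
by rewrite integralD// S0 im0 adde0.
Qed.

(** The increments telescope to [f (X 1, ..., X n) - mean_value] and each of them
    has mean zero. *)
Lemma expectation_fX : fine ('E_P[fX])%E = mean_value.
Proof.
rewrite unlock; under eq_integral do rewrite fXE EFinD.
have [iS S0] := sum_incr_centered (leqnn n).
rewrite integralD//; last exact: (finite_measure_integrable_cst P mean_value).
by rewrite S0 add0e integral_cst//= probability_setT mule1.
Qed.

Lemma integrable_fX : P.-integrable setT (EFin \o fX).
Proof.
rewrite (_ : EFin \o fX =
    (fun w => (\sum_(1 <= k < n.+1) incr k w)%:E) \+ cst mean_value%:E)%E.
  apply: integrableD => //; first exact: (sum_incr_centered (leqnn n)).1.
  exact: (finite_measure_integrable_cst P mean_value).
by apply/funext => w /=; rewrite fXE EFinD.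
Qed.

Lemma measurable_fX : measurable_fun setT fX.
Proof. by apply/measurable_EFinP; exact: measurable_int integrable_fX. Qed.

(** Unless some increment exceeds the level [y], truncation at [y] changes
    nothing; the truncated sum is handled by the exponential Markov
    inequality. *)
Lemma upper_tail (M : Omega -> \bar R) (t l y : R) : 0 <= l -> 0 <= y ->
  measurable_fun setT M ->
  (forall k w, (1 <= k <= n)%N -> incr_bound k w <= M w)%E ->
  (P [set w | (t < fX w - fine ('E_P[fX])%E)%R] <=
   P [set w | y%:E < M w] +
   (expR (l ^+ 2 * expR (l * y) * V - l * t))%:E)%E.
Proof.
move=> l0 y0 mM leM.
have mpsum : measurable_fun setT (psum l y n).
  apply: (measurableT_comp (f := psum l y n : past n -> R) (g := Z n)) => //.
  by apply: measurable_psum; rewrite n_gt0 leqnn.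
pose A := [set w | (y%:E < M w)%E]; pose B := [set w | l * t <= psum l y n w].
have mA : measurable A.
  by rewrite -[A]setTI; apply: emeasurable_fun_o_infty.
have mB : measurable B.
  have := mpsum measurableT `[l * t, +oo[%classic (measurable_itv _).
  rewrite setTI [X in measurable X -> _](_ : _ = B)//.
  by apply/seteqP; split=> w /=; rewrite in_itv/= andbT.
have PB : (P B <= (expR (l ^+ 2 * expR (l * y) * V - l * t))%:E)%E.
  rewrite expRD EFinM -(setIT B) -integral_indic//.
  apply: (@le_trans _ _ (\int[P]_w ((expR (- (l * t)))%:E * (expR (psum l y n w))%:E))%E).
    apply: ge0_le_integral => //.
    - by apply/measurable_EFinP; exact: measurable_indic.
    - apply: measurable_funeM; apply/measurable_EFinP.
      exact: measurableT_comp.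
    - move=> w _; rewrite indicE lee_fin -expRD.
      case: (boolP (w \in B)) => [|_]; last exact: expR_ge0.
      by rewrite inE /B/= => Bw; rewrite -expR0 ler_expR addrC subr_ge0.
  rewrite ge0_integralZl//; last first.
    by apply/measurable_EFinP; exact: measurableT_comp.
  rewrite muleC lee_wpmul2r ?lee_fin ?expR_ge0//.
  by apply: expR_psum_le; rewrite ?n_gt0 ?leqnn.
rewrite expectation_fX.
apply: (@le_trans _ _ (P (A `|` B))).
  apply: le_measure; rewrite ?inE; [|exact: measurableU|].
    have mS : measurable_fun setT (fun w => fX w - mean_value).
      by apply: measurable_funB => //; exact: measurable_fX.
    have := mS measurableT `]t, +oo[%classic (measurable_itv _).
    rewrite setTI [X in measurable X -> _](_ : _ = [set w | t < fX w - mean_value])//.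
    by apply/seteqP; split=> w /=; rewrite in_itv/= andbT.
  move=> w /= tS; case: (boolP (y%:E < M w)%E) => [|]; first by left.
  rewrite -leNgt => My; right; rewrite /B /psum/=.
  rewrite (_ : \sum_(1 <= k < n.+1) _ = l * \sum_(1 <= k < n.+1) incr k w).
    by rewrite ler_wpM2l// ltW//; move: tS; rewrite fXE addrK.
  rewrite mulr_sumr; apply: eq_big_nat => k; rewrite ltnS => kn.
  congr (_ * _); apply/min_idPl.
  apply: (le_trans (ler_norm _)); rewrite -lee_fin.
  exact: (le_trans (incr_le w kn) (le_trans (leM k w kn) My)).
apply: (le_trans (measureU2 _ _ _)) => //.
by rewrite leeD2l.
Qed.

End chain.

(** * From exponential to polynomial tails *)

(** The choice of the exponential parameter. With [a ^+ 2 * V < 1], where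
    [a = 3 * q / t], take [l] such that [expR (3 * l * y) = (a ^+ 2 * V)^-1] with
    [y = a^-1]. Then the quadratic term of the exponent is at most [1], because
    [(l * y) ^+ 2 <= expR (2 * l * y)], and [expR (- l * t)] is the announced
    power. If [V = 0] the exponent is just [- l * t] and [l] tends to infinity;
    if [a ^+ 2 * V >= 1] the bound exceeds [1]. *)
Lemma optimize_exponent (R : realType) (q t V : R) (A B : \bar R) :
  0 < q -> 0 < t -> 0 <= V -> (0 <= B)%E -> (A <= 1)%E ->
  (forall l, 0 <= l -> (A <= B +
     (expR (l ^+ 2 * expR (l * (t / (3 * q))) * V - l * t))%:E)%E) ->
  (A <= B + (expR 1 * ((3 * q / t) ^+ 2 * V) `^ q)%:E)%E.
Proof.
move=> q0 t0 V0 B0 A1 AB.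
have [Vz|Vn0] := eqVneq V 0.
  rewrite Vz mulr0 powR0 ?gt_eqF// mulr0 adde0.
  apply/lee_addgt0Pr => e e0.
  (* This choice of [l] makes [expR (- l * t)] at most [e]. *)
  apply: (le_trans (AB (`|ln e| / t) _)); first by rewrite divr_ge0// ltW.
  rewrite leeD2l// lee_fin Vz mulr0 sub0r divfK ?gt_eqF//.
  rewrite -[leRHS](@lnK _ e) ?posrE// ler_expR lerNl.
  by rewrite -normrN ler_norm.
have Vpos : 0 < V by rewrite lt_neqAle eq_sym Vn0.
set y := t / (3 * q) in AB; set a := 3 * q / t.
have y0 : 0 < y by rewrite divr_gt0// mulr_gt0.
have ay : a = y^-1 by rewrite /a /y invf_div.
have a0 : 0 < a by rewrite ay invr_gt0.
have [le1|gt1] := lerP 1 (a ^+ 2 * V).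
  apply: (le_trans A1); rewrite -[leLHS]add0e leeD// lee_fin.
  rewrite -[leLHS]mulr1 ler_pM//.
    by rewrite -expR0 ler_expR.
  apply: (@le_trans _ _ (1 `^ q)); first by rewrite powR1.
  by rewrite ge0_ler_powR// ?nnegrE ?(ltW q0)// (le_trans _ le1).
have aV0 : 0 < a ^+ 2 * V by rewrite mulr_gt0// exprn_gt0.
(* [u] is the value of [l * y]. *)
pose u := - ln (a ^+ 2 * V) / 3.
have u0 : 0 <= u by rewrite divr_ge0// oppr_ge0 ln_le0// ltW.
apply: (le_trans (AB (u * a) _)); first by rewrite mulr_ge0// ltW.
rewrite leeD2l// lee_fin ay mulfVK ?gt_eqF// -ay.
have -> : (a ^+ 2 * V) `^ q = expR (- (u * a * t)).
  rewrite /powR gt_eqF//; congr expR.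
  by rewrite /u /a; field; rewrite !gt_eqF.
rewrite -expRD ler_expR lerD2r.
have -> : 1 = expR (3 * u) * (a ^+ 2 * V).
  rewrite -[X in _ * X](@lnK _ (a ^+ 2 * V)) ?posrE// -expRD.
  by rewrite -[LHS]expR0; congr expR; rewrite /u; field.
have -> : (u * a) ^+ 2 * expR u * V = u ^+ 2 * expR u * (a ^+ 2 * V) by ring.
rewrite ler_pM2r//.
have uu : u <= expR u by apply: le_trans (expR_ge1Dx u); rewrite lerDr.
have -> : expR (3 * u) = expR u ^+ 2 * expR u.
  by rewrite -expRM_natl -expRD; congr expR; ring.
by rewrite ler_wpM2r ?expR_ge0// lerXn2r// nnegrE ?expR_ge0.
Qed.

Lemma measurable_bigmaxe d (T : measurableType d) (R : realType) (I : eqType)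
    (s : seq I) (h : I -> T -> \bar R) :
  (forall i, i \in s -> measurable_fun setT (h i)) ->
  measurable_fun setT (fun w => \big[maxe/-oo%E]_(i <- s) h i w).
Proof.
elim: s => [|i s IHs] mh.
  by under eq_fun do rewrite big_nil; exact: measurable_cst.
under eq_fun do rewrite big_cons.
apply: measurable_maxe; first by apply: mh; rewrite mem_head.
by apply: IHs => j js; apply: mh; rewrite inE js orbT.
Qed.

Lemma weak_moment_tail d (Omega : measurableType d) (R : realType)
    (P : probability Omega R) (p y : R) (M : Omega -> \bar R) :
  0 < y -> measurable_fun setT M ->
  (P [set w | y%:E < M w] <= ((y `^ p)^-1)%:E * weak_moment P p M)%E.
Proof.
move=> y0 mM.
have yp : 0 < y `^ p by exact: powR_gt0.
have mlt (N : Omega -> \bar R) : measurable_fun setT N ->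
    measurable [set w | (y%:E < N w)%E].
  by move=> mN; rewrite -[X in measurable X]setTI; exact: emeasurable_fun_o_infty.
rewrite muleC lee_pdivlMr// muleC.
apply: (@le_trans _ _ ((y `^ p)%:E * P [set w | y%:E < `|M w|])%E).
  apply: lee_wpmul2l; first by rewrite lee_fin ltW.
  apply: le_measure; rewrite ?inE.
  - exact: mlt.
  - by apply: mlt; exact: measurableT_comp.
  - by move=> w /= /lt_le_trans; apply; exact: lee_abs.
by apply: ereal_sup_ubound; exists y.
Qed.

Theorem proposition3p15 (R : realType) (p : R) (hp : 2 <= p) :
  exists C1 C2 : R, 0 < C1 /\ 0 < C2 /\
  forall (d : measure_display) (Omega : measurableType d)
    (P : probability Omega R)
    (SX SY : completeMetricType R) (sepX : separable SX) (sepY : separable SY)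
    (eps : nat -> {RV P >-> borel SY}) (X : nat -> {RV P >-> borel SX})
    (F : borel SX * borel SY -> borel SX) (rho C : R)
    (n : nat) (f : ('I_n -> SX) -> R) (V1 V2 : R),
  iid [set i | (1 <= i)%N] eps ->
  independent_systems P (sigma_rv (X 1%N))
    (sigma_family [set i | (2 <= i)%N] eps) ->
  measurable_fun setT F ->
  (forall k, (2 <= k)%N -> forall w, X k w = F (X k.-1 w, eps k w)) ->
  0 <= rho < 1 ->
  0 < C ->
  (forall x x' : SX,
    (\int[P]_w (mdist (F (x, eps 1%N w) : SX) (F (x', eps 1%N w)))%:E
      <= (rho * mdist x x')%:E)%E) ->
  (forall (x : SX) (y y' : SY),
    mdist (F (x, y) : SX) (F (x, y')) <= C * mdist y y') ->
  (1 <= n)%N ->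
  lipschitz1 f ->
  0 <= V1 ->
  0 <= V2 ->
  let GX : SX -> \bar R := mean_dist (distribution P (X 1%N)) 1 in
  let Geps : SY -> \bar R := mean_dist (distribution P (eps 1%N)) C in
  let K := geomsum rho in
  (\int[P]_w (GX (X 1%N w) ^+ 2) <= V1%:E)%E ->
  (\int[P]_w (Geps (eps 1%N w) ^+ 2) <= V2%:E)%E ->
  let V := V1 * K n.-1 ^+ 2 + V2 * \sum_(2 <= k < n.+1) K (n - k)%N ^+ 2 in
  let fX : Omega -> R := fun w => f (fun i : 'I_n => X i.+1 w) in
  let Sn : Omega -> R := fun w => fX w - fine ('E_P[fX])%E in
  let M : Omega -> \bar R := fun w => maxe ((K n.-1)%:E * GX (X 1%N w))%E
    (\big[maxe/-oo%E]_(2 <= i < n.+1) ((K (n - i)%N)%:E * Geps (eps i w))%E) in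
  forall t : R, 0 < t ->
  (P [set w | (t < `|Sn w|)%R]
    <= ((t `^ p)^-1)%:E *
       ((C1 * V `^ (p / 2))%:E + C2%:E * weak_moment P p M))%E.
Proof.
(* The increments are truncated at [t / c]; this level makes the exponential
   bound decay with the power [q = p / 2] of [V / t ^ 2]. *)
pose q := p / 2; pose c := 3 * q.
have p0 : 0 < p by rewrite (lt_le_trans _ hp).
have q0 : 0 < q by rewrite divr_gt0.
have c0 : 0 < c by rewrite mulr_gt0.
exists (2 * expR 1 * c `^ p), (2 * c `^ p).
split; first by rewrite !mulr_gt0 ?expR_gt0 ?powR_gt0.
split; first by rewrite mulr_gt0 ?powR_gt0.
move=> d Omega P SX SY sepX sepY eps X F rho C n f V1 V2 iid_eps X1_eps mF recX
  /andP[rho0 _] C0 contractF lipF n1 lipf V10 V20 GX Geps K GX_V1 Geps_V2 V fX Sn M t t0.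
have GXfin := mean_dist_lty ler01 GX_V1.
have Gepsfin := mean_dist_lty (ltW C0) Geps_V2.
have V0 : 0 <= V.
  rewrite addr_ge0// mulr_ge0 ?sqr_ge0//.
  by apply: sumr_ge0 => k _; exact: sqr_ge0.
have VE : V = \sum_(1 <= k < n.+1) incr_var rho V1 V2 n k.
  rewrite big_ltn// /incr_var eqxx subn1 mulrC; congr (_ + _).
  rewrite mulr_sumr; apply: eq_big_nat => k /andP[k2 _].
  by rewrite gtn_eqF// mulrC.
have mM : measurable_fun setT M.
  apply: measurable_maxe.
    apply: measurable_funeM.
    exact: (measurableT_comp (measurable_mean_dist sepX ler01 GXfin)).
  apply: measurable_bigmaxe => i _; apply: measurable_funeM.
  exact: (measurableT_comp (measurable_mean_dist sepY (ltW C0) Gepsfin)).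
have leM k w : (1 <= k <= n)%N -> (incr_bound eps X rho C n k w <= M w)%E.
  move=> /andP[k1 kn]; rewrite /incr_bound /M le_max.
  case: eqP => [->|/eqP k1'].
    by rewrite subn1 lexx.
  apply/orP; right.
  apply: (Order.TotalTheory.le_bigmax_seq -oo%E k xpredT
    (fun i => ((K (n - i)%N)%:E * Geps (eps i w))%E)) => //.
  by rewrite mem_index_iota ltnS kn andbT ltn_neqAle eq_sym k1'.
pose a := c / t.
have a0 : 0 < a by rewrite divr_gt0.
have y0 : 0 < t / c by rewrite divr_gt0.
have apE : a `^ p = c `^ p * (t `^ p)^-1.
  have tp : t `^ p != 0 by rewrite gt_eqF// powR_gt0.
  apply: (mulIf tp); rewrite mulfVK// -powRM ?ltW//.
  by rewrite /a divfK ?gt_eqF.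
have ypE : ((t / c) `^ p)^-1 = a `^ p.
  have yp : (t / c) `^ p != 0 by rewrite gt_eqF// powR_gt0.
  apply: (mulIf yp); rewrite mulVf// -powRM ?ltW//.
  by rewrite /a mulrA divfK ?gt_eqF// divff ?gt_eqF// powR1.
set W := weak_moment P p M.
have mtail (S : Omega -> R) : measurable_fun setT S -> measurable [set w | t < S w].
  move=> mS; have := mS measurableT `]t, +oo[%classic (measurable_itv _).
  rewrite setTI [X in measurable X -> _](_ : _ = [set w | t < S w])//.
  by apply/seteqP; split=> w /=; rewrite in_itv/= andbT.
(* The upper tail for an arbitrary Lipschitz functional, to be applied to [f] and
   to its opposite. *)
have tail g : lipschitz1 g ->
    let S w := g (fun i : 'I_n => X i.+1 w) -
      fine 'E_P[(fun w => g (fun i : 'I_n => X i.+1 w))]%E in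
    measurable [set w | t < S w] /\
    (P [set w | (t < S w)%R] <= (a `^ p)%:E * W + (expR 1 * (a `^ p * V `^ q))%:E)%E.
  move=> lipg S.
  have mS : measurable_fun setT S.
    apply: measurable_funB => //.
    exact: (measurable_fX sepX sepY iid_eps X1_eps mF recX rho0 C0 contractF lipF
      GX_V1 Geps_V2 lipg n1).
  split; first exact: mtail.
  have -> : a `^ p * V `^ q = (a ^+ 2 * V) `^ q.
    rewrite powRM ?sqr_ge0// -powR_mulrn ?ltW// -powRrM; congr (_ `^ _ * _).
    by rewrite /q; field.
  apply: (@le_trans _ _ (P [set w | (t / c)%:E < M w]%E +
      (expR 1 * (a ^+ 2 * V) `^ q)%:E)%E).
    apply: optimize_exponent => //.
      by apply: probability_le1; exact: mtail.
    move=> l l0; rewrite VE.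
    exact: (upper_tail sepX sepY iid_eps X1_eps mF recX rho0 C0 contractF lipF
      GX_V1 Geps_V2 lipg n1 t l0 (ltW y0) mM leM).
  by rewrite leeD2r// -ypE; exact: weak_moment_tail.
have lipN : lipschitz1 (fun x => - f x).
  by move=> x x'; rewrite -opprD normrN; exact: lipf.
have [m1 t1] := tail _ lipf; have [m2 t2] := tail _ lipN.
have EN : fine 'E_P[(fun w => (- f (fun i : 'I_n => X i.+1 w))%R)]%E = - fine 'E_P[fX]%E.
  have ifX := integrable_fX sepX sepY iid_eps X1_eps mF recX rho0 C0 contractF lipF
    GX_V1 Geps_V2 lipf n1.
  rewrite unlock; under eq_integral do rewrite -mulN1r EFinM.
  by rewrite integralZl// mulN1e fineN.
have W0 : (0 <= W)%E.
  apply: le_trans (ereal_sup_ubound _); last by exists 1; [exact: ltr01|reflexivity].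
  by rewrite mule_ge0.
apply: (@le_trans _ _ ((a `^ p)%:E * W + (expR 1 * (a `^ p * V `^ q))%:E +
  ((a `^ p)%:E * W + (expR 1 * (a `^ p * V `^ q))%:E))%E).
  apply: (le_trans _ (leeD t1 t2)); apply: le_trans (measureU2 _ _ _) => //.
  apply: le_measure; rewrite ?inE.
  - apply: (mtail (fun w => `|Sn w|)).
    apply: measurableT_comp => //; apply: measurable_funB => //.
    exact: (measurable_fX sepX sepY iid_eps X1_eps mF recX rho0 C0 contractF lipF
      GX_V1 Geps_V2 lipf n1).
  - exact: measurableU.
  - move=> w /=; rewrite lter_normr => /orP[h|h]; [left|right] => //.
    by rewrite EN -opprD.
rewrite apE; clear tail t1 t2; clearbody W; case: W W0 => [W| |]//= W0.
  rewrite lee_fin -/q; lra.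
have cp2 : (0 < (2 * c `^ p)%:E)%E by rewrite lte_fin mulr_gt0 ?powR_gt0.
have tp : (0 < ((t `^ p)^-1)%:E)%E by rewrite lte_fin invr_gt0 powR_gt0.
by rewrite (gt0_muley cp2) addey// (gt0_muley tp) leey.
Qed.
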